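(* Let $(x^*,\eta^* ),(\omega,\omega_0)\in\mathbb{R}^n\times\mathbb{R}$, $(\tilde\omega,\tilde\omega_0):=(H\omega,-\omega_0)$, and let $(\gamma,\gamma_0)\in P(x^*,\eta^* )$ be maximal in $P(x^*,\eta^* )$ with respect to the objective $(\tilde\omega,\tilde\omega_0)$ (i.e. it maximizes $\tilde\omega^\top\gamma'+\tilde\omega_0\gamma'_0$ over $(\gamma',\gamma'_0)\in P(x^*,\eta^* )$), such that $\tilde\omega^\top\gamma+\tilde\omega_0\gamma_0<0$. Then the inequality $\gamma^\top Hx-\gamma_0\eta\le\gamma^\top b$ supports $\operatorname{epi}(z)$.
   Context: Let $H \in \mathbb{R}^{m\times n}$, $A\in\mathbb{R}^{m\times k}$, $b\in\mathbb{R}^m$, $d\in\mathbb{R}^k$. Define $z(x) := \min_{y\in\mathbb{R}^k}\{d^\top y : Ay \le b-Hx\}$ for $x\in\mathbb{R}^n$, with epigraph $$\operatorname{epi}(z) = \{(x,\eta)\in\mathbb{R}^n\times\mathbb{R} : \exists y\in\mathbb{R}^k:\ Ay\le b-Hx,\ d^\top y\le\eta\}.$$ The alternative polyhedron is $$P(x^*,\eta^* ) := \{(\gamma,\gamma_0)\in\mathbb{R}^m\times\mathbb{R} : \gamma,\gamma_0\ge 0,\ \gamma^\top A+\gamma_0 d^\top=0,\ \gamma^\top(b-Hx^* )+\gamma_0\eta^*=-1\}.$$ An inequality (equivalently, the halfspace it defines) supports a set $C$ if it is satisfied by all points of $C$ and satisfied with equality by at least one point of $C$. *)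

(* Defs.v *)
From mathcomp Require Import all_boot all_order all_algebra.
From mathcomp Require Import classical_sets reals.

Set Implicit Arguments.
Unset Strict Implicit.
Unset Printing Implicit Defensive.

Import Order.TTheory GRing.Theory Num.Theory.
Local Open Scope classical_set_scope.
Local Open Scope ring_scope.

Definition dotv (R : realType) (p : nat) (u v : 'cV[R]_p) : R :=
  (u^T *m v) 0 0.

Definition lev (R : realType) (p : nat) (u v : 'cV[R]_p) : Prop :=
  forall i, u i 0 <= v i 0.

(* The epigraph of z(x) = min { d^T y : A y <= b - H x }, given directly by
   feasible points y.  An x with no feasible y contributes no point (z(x) is
   +oo), and an x for which the program is unbounded contributes every eta
   (z(x) is -oo). *)
Definition epi_z (R : realType) (m n k : nat)
    (H : 'M[R]_(m, n)) (A : 'M[R]_(m, k)) (b : 'cV[R]_m) (d : 'cV[R]_k) :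
    set ('cV[R]_n * R) :=
  [set p | exists y : 'cV[R]_k, lev (A *m y) (b - H *m p.1) /\ dotv d y <= p.2].

Definition alt_polyhedron (R : realType) (m n k : nat)
    (H : 'M[R]_(m, n)) (A : 'M[R]_(m, k)) (b : 'cV[R]_m) (d : 'cV[R]_k)
    (xstar : 'cV[R]_n) (etastar : R) : set ('cV[R]_m * R) :=
  [set g | [/\ lev 0 g.1, 0 <= g.2,
               g.1^T *m A + g.2 *: d^T = 0
             & dotv g.1 (b - H *m xstar) + g.2 * etastar = -1]].

Definition maximizes (R : realType) (T : Type) (f : T -> R) (S : set T)
    (p : T) : Prop :=
  S p /\ forall q, S q -> f q <= f p.

(* The inequality f p <= c, in the unknown p, supports C. *)
Definition supports (R : realType) (T : Type) (f : T -> R) (c : R)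
    (C : set T) : Prop :=
  (forall p, C p -> f p <= c) /\ (exists p, C p /\ f p = c).

(* Main.v *)
Require Import Defs.
From mathcomp Require Import all_boot all_order all_algebra.
From mathcomp Require Import classical_sets reals.
From mathcomp Require Import ring lra.

Set Implicit Arguments.
Unset Strict Implicit.
Unset Printing Implicit Defensive.

Import Order.TTheory GRing.Theory Num.Theory.
Local Open Scope ring_scope.

(** By Farkas' lemma, whenever a point lies outside epi(z) there is a
    certificate (l, l0) >= 0 with l^T A + l0 d^T = 0 that it violates.  Let
    v := - (tomega^T gamma + tomega0 gamma0) > 0.  The supporting point is
    (xstar, etastar) + v^-1 (omega, omega0): the inequality given by
    (gamma, gamma0) is tight there.  If that point were outside epi(z), adding
    a small multiple of its certificate to (gamma, gamma0) and rescaling back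
    into the alternative polyhedron would give a larger objective value. *)

(** The second hypothesis is the cross-multiplied form of [r j / a j <= r i / a i]: every lower
    bound on [t] lies below every upper bound. The least upper bound then solves the system. *)
Lemma linear_system1 (R : realFieldType) (I : finType) (a r : I -> R) :
    (forall i, a i = 0 -> 0 <= r i) ->
    (forall i j, 0 < a i -> a j < 0 -> 0 <= - a j * r i + a i * r j) ->
  exists t, forall i, a i * t <= r i.
Proof.
move=> r0 rij; case: (pickP (fun i => 0 < a i)) => [i0 i0P|aN].
  have [i ai_gt0 minP] := arg_minP (P := fun i => 0 < a i) (fun i => r i / a i) i0P.
  exists (r i / a i) => j; case: (ltgtP (a j) 0) => aj.
  - have : 0 <= (- a j * r i + a i * r j) / a i by rewrite divr_ge0 ?rij// ltW.
    suff -> : (- a j * r i + a i * r j) / a i = r j - a j * (r i / a i).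
      by rewrite subr_ge0.
    by field; rewrite gt_eqF.
  - by rewrite mulrC -ler_pdivlMr// minP.
  - by rewrite aj mul0r r0.
(* Without upper bounds, [t] only has to exceed each lower bound [r j / a j]. *)
exists (\sum_i `|r i / a i|) => j; case: (ltgtP (a j) 0) => aj.
- rewrite mulrC -ler_ndivrMr// (bigD1 j)//= (le_trans (ler_norm _))//.
  by rewrite lerDl sumr_ge0.
- by rewrite aN in aj.
- by rewrite aj mul0r r0.
Qed.

(* Weights of the Fourier-Motzkin combination of the constraints indexed by
   [p.1] and [p.2]; a constraint that does not involve the eliminated variable
   is kept on the diagonal, and irrelevant pairs get zero weights. *)
Definition fm_weight (R : realFieldType) (I : finType) (a : I -> R)
    (p : I * I) (h : I) : R :=
  if (0 < a p.1) && (a p.2 < 0)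
  then - a p.2 * (h == p.1)%:R + a p.1 * (h == p.2)%:R
  else ((p.1 == p.2) && (a p.1 == 0))%:R * (h == p.1)%:R.

Lemma fm_weight_ge0 (R : realFieldType) (I : finType) (a : I -> R) p h :
  0 <= fm_weight a p h.
Proof.
rewrite /fm_weight; case: ifPn => [/andP[a1 a2]|_]; last by rewrite mulr_ge0.
by rewrite addr_ge0 // mulr_ge0 // ?oppr_ge0 ltW.
Qed.

Lemma sum_fm_weight (R : realFieldType) (I : finType) (a X : I -> R) p :
  \sum_h fm_weight a p h * X h =
  if (0 < a p.1) && (a p.2 < 0) then - a p.2 * X p.1 + a p.1 * X p.2
  else ((p.1 == p.2) && (a p.1 == 0))%:R * X p.1.
Proof.
have sumD i c : \sum_h c * (h == i)%:R * X h = c * X i.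
  rewrite (bigD1 i)//= eqxx mulr1 big1 ?addr0// => h /negPf ->.
  by rewrite mulr0 mul0r.
rewrite /fm_weight; case: ifPn => _; last exact: sumD.
by under eq_bigr do rewrite mulrDl; rewrite big_split /= !sumD.
Qed.

(** Fourier-Motzkin elimination, by induction on the number of variables: variable [ord0] is
    eliminated, and the combined constraints are indexed by [I * I]. *)
Lemma farkas (R : realFieldType) (k : nat) (I : finType)
    (M : I -> 'I_k -> R) (q : I -> R) :
  (exists y : 'I_k -> R, forall i, \sum_j M i j * y j <= q i) \/
  (exists l : I -> R, [/\ forall i, 0 <= l i,
     forall j, \sum_i l i * M i j = 0 & \sum_i l i * q i < 0]).
Proof.
elim: k I M q => [|k IHk] I M q.
  case: (pickP (fun i => q i < 0)) => [i qi|qN]; [right|left].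
    exists (fun h => (h == i)%:R); split=> // [[]//|].
    rewrite (bigD1 i)//= eqxx mul1r big1 ?addr0// => h /negPf ->.
    by rewrite mul0r.
  by exists (fun=> 0) => i; rewrite big_ord0 leNgt qN.
pose a i := M i ord0.
pose w := fm_weight a.
have [[z zP]|[l [l0 lM lq]]] := IHk (I * I)%type
    (fun p j => \sum_h w p h * M h (lift ord0 j)) (fun p => \sum_h w p h * q h).
  (* [r h] is what constraint [h] leaves for the eliminated variable once the others are set to
     [z]. *)
  left; pose r h := q h - \sum_j M h (lift ord0 j) * z j.
  have wr p : 0 <= \sum_h w p h * r h.
    under eq_bigr do rewrite mulrBr.
    rewrite sumrB subr_ge0; apply: le_trans (zP p).
    under eq_bigr do rewrite mulr_sumr.
    rewrite exchange_big /= le_eqVlt; apply/orP; left; apply/eqP.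
    apply: eq_bigr => j _; rewrite mulr_suml.
    by apply: eq_bigr => h _; rewrite mulrA.
  have [||t tP] := @linear_system1 _ _ a r.
  - move=> i ai; have := wr (i, i).
    by rewrite sum_fm_weight /= ai ltxx /= !eqxx mul1r.
  - by move=> i j ai aj; have := wr (i, j); rewrite sum_fm_weight /= ai aj.
  exists (fun j => if unlift ord0 j is Some j' then z j' else t) => i.
  rewrite big_ord_recl unlift_none.
  under eq_bigr do rewrite liftK.
  by rewrite -lerBrDr; exact: tP.
(* A certificate for the combined constraints pulls back through the weights; in column [ord0] each
   combination already cancels. *)
right; exists (fun h => \sum_p l p * w p h).
have comb X : \sum_h (\sum_p l p * w p h) * X h =
    \sum_p l p * \sum_h w p h * X h.
  under eq_bigr do rewrite mulr_suml.
  rewrite exchange_big /=; apply: eq_bigr => p _; rewrite mulr_sumr.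
  by apply: eq_bigr => h _; rewrite mulrA.
split=> [h|j|]; last by rewrite comb.
  by rewrite sumr_ge0 // => p _; rewrite mulr_ge0 // fm_weight_ge0.
rewrite comb; case: (unliftP ord0 j) => [j' ->|->]; first exact: lM.
apply: big1 => p _; rewrite sum_fm_weight /= -/(a _) -/(a _).
case: ifPn => _; first by rewrite mulNr [a p.2 * _]mulrC addNr mulr0.
by case: (a p.1 =P 0) => [->|_]; rewrite ?andbF ?mul0r !mulr0.
Qed.

Section Dotv.
Context {R : realType}.

Lemma dotvE p (u v : 'cV[R]_p) : dotv u v = \sum_i u i 0 * v i 0.
Proof. by rewrite /dotv mxE; apply: eq_bigr => i _; rewrite mxE. Qed.

Lemma dotvC p (u v : 'cV[R]_p) : dotv u v = dotv v u.
Proof. by rewrite !dotvE; apply: eq_bigr => i _; rewrite mulrC. Qed.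

Lemma dotvDr p (u v w : 'cV[R]_p) : dotv u (v + w) = dotv u v + dotv u w.
Proof. by rewrite /dotv mulmxDr mxE. Qed.

Lemma dotvZr p a (u v : 'cV[R]_p) : dotv u (a *: v) = a * dotv u v.
Proof. by rewrite /dotv -scalemxAr mxE. Qed.

Lemma dotvBr p (u v w : 'cV[R]_p) : dotv u (v - w) = dotv u v - dotv u w.
Proof. by rewrite dotvDr -scaleN1r dotvZr mulN1r. Qed.

Lemma dotvDl p (u v w : 'cV[R]_p) : dotv (u + v) w = dotv u w + dotv v w.
Proof. by rewrite dotvC dotvDr !(dotvC w). Qed.

Lemma dotvZl p a (u v : 'cV[R]_p) : dotv (a *: u) v = a * dotv u v.
Proof. by rewrite dotvC dotvZr dotvC. Qed.

Lemma ler_dotv p (g u v : 'cV[R]_p) : lev 0 g -> lev u v ->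
  dotv g u <= dotv g v.
Proof.
move=> g0 uv; rewrite !dotvE ler_sum // => i _.
by rewrite ler_wpM2l //; have := g0 i; rewrite mxE.
Qed.

Lemma dotv_mulmx_comb m k (A : 'M[R]_(m, k)) (d : 'cV[R]_k) g g0 y :
  g^T *m A + g0 *: d^T = 0 -> dotv g (A *m y) = - (g0 * dotv d y).
Proof.
move=> gA; apply/eqP; rewrite -addr_eq0; apply/eqP.
have : ((g^T *m A + g0 *: d^T) *m y) 0 0 = 0 by rewrite gA mul0mx mxE.
by rewrite mulmxDl -scalemxAl -mulmxA mxE [X in _ + X]mxE.
Qed.

End Dotv.

(** Farkas for the rows of [A] together with the row [d^T y <= eta], which gets the index [None] and
    the multiplier [l0]. *)
Lemma epi_z_certificate (R : realType) (m n k : nat)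
    (H : 'M[R]_(m, n)) (A : 'M[R]_(m, k)) (b : 'cV[R]_m) (d : 'cV[R]_k) x eta :
  epi_z H A b d (x, eta) \/
  exists l l0, [/\ lev 0 l, 0 <= l0, l^T *m A + l0 *: d^T = 0 &
                   dotv l (b - H *m x) + l0 * eta < 0].
Proof.
have [[y yP]|[l [l0 lM lq]]] := @farkas R k (option 'I_m)
  (fun i j => if i is Some i' then A i' j else d j 0)
  (fun i => if i is Some i' then (b - H *m x) i' 0 else eta).
  left; exists (\col_j y j); split=> [i|].
    by rewrite mxE; under eq_bigr do rewrite mxE; exact: (yP (Some i)).
  by rewrite dotvE; under eq_bigr do rewrite mxE; exact: (yP None).
have sumO F : \sum_(i : option 'I_m) F i = F None + \sum_i F (Some i) :> R.
  rewrite (bigD1 None)//=; congr (_ + _).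
  rewrite (reindex_omap Some id) /=; last by case.
  by apply: eq_bigl => i; rewrite eqxx.
right; exists (\col_i l (Some i)), (l None); split=> //.
- by move=> i; rewrite !mxE.
- apply/matrixP => i j; rewrite !mxE ord1 -[RHS](lM j) sumO addrC.
  by congr (_ + _); apply: eq_bigr => h _; rewrite !mxE.
- rewrite dotvE addrC; move: lq; rewrite sumO /=.
  by under [in X in _ -> X]eq_bigr do rewrite mxE.
Qed.

Theorem corollary10 (R : realType) (m n k : nat)
    (H : 'M[R]_(m, n)) (A : 'M[R]_(m, k)) (b : 'cV[R]_m) (d : 'cV[R]_k)
    (xstar : 'cV[R]_n) (etastar : R) (omega : 'cV[R]_n) (omega0 : R)
    (gamma : 'cV[R]_m) (gamma0 : R) :
  let tomega : 'cV[R]_m := H *m omega in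
  let tomega0 : R := - omega0 in
  maximizes (fun g : 'cV[R]_m * R => dotv tomega g.1 + tomega0 * g.2)
    (alt_polyhedron H A b d xstar etastar) (gamma, gamma0) ->
  dotv tomega gamma + tomega0 * gamma0 < 0 ->
  supports (fun p : 'cV[R]_n * R => dotv gamma (H *m p.1) - gamma0 * p.2)
    (dotv gamma b) (epi_z H A b d).
Proof.
move=> tomega tomega0 [[/= g_ge0 g0_ge0 gA gP] gmax] vlt0.
split=> [[x eta] [y [/= Ay dy]]|].
  (* Weak duality: pairing [Ay] with [gamma] turns its left side into [- gamma0 * dotv d y]. *)
  have := ler_dotv g_ge0 Ay; rewrite (dotv_mulmx_comb _ gA).
  have : gamma0 * dotv d y <= gamma0 * eta by rewrite ler_wpM2l.
  rewrite dotvBr; lra.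
pose f l l0 := dotv tomega l + tomega0 * l0.
pose g l l0 := dotv l (b - H *m xstar) + l0 * etastar.
set v := f gamma gamma0 in vlt0.
have fv : f gamma gamma0 = v by [].
pose t := - v^-1.
have t_gt0 : 0 < t by rewrite oppr_gt0 invr_lt0.
have tv : t * v = -1 by rewrite mulNr mulVf ?lt_eqF.
(* At [(gamma, gamma0)] the right side is [-1 - t * v = 0], which is the tightness sought. *)
have shift l l0 : dotv l (b - H *m (xstar + t *: omega)) +
    l0 * (etastar + t * omega0) = g l l0 - t * f l l0.
  rewrite /g /f /tomega /tomega0 mulmxDr -scalemxAr !dotvBr dotvDr dotvZr.
  by rewrite (dotvC _ (H *m omega)); ring.
exists (xstar + t *: omega, etastar + t * omega0).
have [inE|[l [l0 [l_ge0 l0_ge0 lA]]]] :=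
    epi_z_certificate H A b d (xstar + t *: omega) (etastar + t * omega0).
  split=> //=; have := shift gamma gamma0.
  by rewrite fv tv /g gP dotvBr; lra.
rewrite shift => lneg; exfalso.
have flin a c (u w : 'cV[R]_m) u0 w0 :
    f (a *: u + c *: w) (a * u0 + c * w0) = a * f u u0 + c * f w w0.
  by rewrite /f dotvDr !dotvZr; ring.
have glin a c (u w : 'cV[R]_m) u0 w0 :
    g (a *: u + c *: w) (a * u0 + c * w0) = a * g u u0 + c * g w w0.
  by rewrite /g dotvDl !dotvZl; ring.
(* [e] is small enough for gamma + e l to keep a negative normalization. *)
pose e := (1 + `|g l l0|)^-1.
have e_gt0 : 0 < e by rewrite invr_gt0 ltr_wpDr.
have s_gt0 : 0 < 1 - e * g l l0.
  rewrite subr_gt0 mulrC ltr_pdivrMr ?ltr_wpDr// mul1r.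
  by rewrite (le_lt_trans (ler_norm _))// ltrDr.
(* [- s] is the value of [g] at [gamma + e l], so dividing by [s] restores the normalization
   [-1]. *)
set s := 1 - e * g l l0 in s_gt0.
have sV_gt0 : 0 < s^-1 by rewrite invr_gt0.
have := gmax (s^-1 *: gamma + (s^-1 * e) *: l, s^-1 * gamma0 + s^-1 * e * l0).
rewrite /= -!/(f _ _) flin fv => fle.
(* Multiplied by [s * t], this bound becomes [0 <= e * (g l l0 - t * f l l0)], contradicting
   [lneg]. *)
suff : s^-1 * v + s^-1 * e * f l l0 <= v.
  rewrite -mulrA -mulrDr mulrC ler_pdivrMr// => le_vs.
  have : t * (v + e * f l l0) <= t * (v * s) by rewrite ler_pM2l.
  rewrite mulrDr !mulrA tv mulN1r /s => le_ts.
  have : e * (g l l0 - t * f l l0) < 0 by rewrite pmulr_rlt0.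
  move: le_ts; rewrite [t * e]mulrC mulrBr mulrA; lra.
apply: fle; split=> /=.
- move=> i; have := g_ge0 i; have := l_ge0 i; rewrite !mxE => li gi.
  by rewrite addr_ge0 // !mulr_ge0 // ltW.
- by rewrite addr_ge0 // !mulr_ge0 // ltW.
- rewrite linearD !linearZ /= mulmxDl -!scalemxAl scalerDl -!scalerA.
  by rewrite addrACA -!scalerDr gA lA scaler0 addr0 scaler0.
- rewrite -/(g _ _) glin {1}/g gP -mulrA -mulrDr.
  have -> : -1 + e * g l l0 = - s by rewrite /s; ring.
  by rewrite mulrN mulVf ?gt_eqF.
Qed.
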